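(* Let $S$ be a sequence of length $n$ over the cyclic group $C_n$ of order $n$. Put $r=MZ(S)$ and $t=|\operatorname{supp}(S)|$. If $r-1>n/2$, then \[ r\le n-\binom{t}{2}. \]
   Context: Groups are written additively; $C_n$ denotes the cyclic group of order $n$. A sequence $S$ over a finite abelian group $G$ is a finite multiset of elements of $G$ (order irrelevant, repetition allowed); a subsequence is a submultiset of occurrences. The length of $S$ is its number of terms counted with multiplicity, and $\operatorname{supp}(S)$ denotes the set of distinct elements of $G$ occurring in $S$. A subsequence is zero-sum if the sum of its terms (with multiplicity) is $0$. $MZ(S)$ is the smallest positive integer $r$ such that $S$ has a zero-sum subsequence of length $r$; if $S$ has no nonempty zero-sum subsequence, $MZ(S)=\infty$. *)

(* Defs.v *)
From mathcomp Require Import all_boot all_order all_algebra.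
From mathcomp Require Import constructive_ereal.

Set Implicit Arguments.
Unset Strict Implicit.
Unset Printing Implicit Defensive.

Import Order.TTheory GRing.Theory Num.Theory.
Local Open Scope ring_scope.

(* A sequence over [G] is given by listing its terms in some order; choosing
   the occurrences of a subsequence amounts to choosing a set of positions. *)
Definition has_zero_sum (G : finZmodType) (S : seq G) (r : nat) : bool :=
  [exists I : {set 'I_(size S)}, (#|I| == r) && (\sum_(i in I) S`_i == 0)].

(* Extended rationals are used so that the value can be [+oo] and be compared
   with [n / 2]. A subsequence has at most [size S] terms, so the minimum may
   be taken over [1 <= r <= size S]; the empty minimum is [+oo]. *)
Definition MZ (G : finZmodType) (S : seq G) : \bar rat :=
  \big[Order.min/+oo%E]_(1 <= r < (size S).+1 | has_zero_sum S r) r%:R%:E.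

Definition supp (G : finZmodType) (S : seq G) : {set G} := [set x in S].

(* The listing order is irrelevant. *)
Lemma has_zero_sumP (G : finZmodType) (S : seq G) (r : nat) :
  reflect (exists T U : seq G,
             [/\ perm_eq (T ++ U) S, size T = r & \sum_(x <- T) x = 0])
          (has_zero_sum S r).
Proof.
have sumI (I : {set 'I_(size S)}) :
    \sum_(i in I) S`_i = \sum_(x <- [seq S`_(val i) | i <- enum I]) x.
  by rewrite big_map big_enum.
apply: (iffP existsP) => [[I /andP[/eqP cI /eqP sI]]|[T [U [pTU sT zT]]]].
  exists [seq S`_(val i) | i <- enum I], [seq S`_(val i) | i <- enum (~: I)].
  split; [|by rewrite size_map -cardE|by rewrite -sumI].
  have eS : [seq S`_(val i) | i <- enum 'I_(size S)] = S.
    by rewrite (map_comp (nth 0 S) val) val_enum_ord map_nth_iota0 // take_size.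
  rewrite -map_cat -[X in perm_eq _ X]eS.
  apply: perm_map; apply: uniq_perm; rewrite ?enum_uniq //.
    rewrite cat_uniq !enum_uniq andbT /=; apply/hasPn => i.
    by rewrite !mem_enum inE.
  by move=> i; rewrite mem_cat !mem_enum !inE orbN.
have/(perm_iotaP 0) [s ps eTU] := pTU.
have us : uniq s by rewrite (perm_uniq ps) iota_uniq.
have ms i : i \in s -> (i < size S)%N by rewrite (perm_mem ps) mem_iota.
pose s1 := take (size T) s.
have eT : T = [seq S`_i | i <- s1] by rewrite /s1 map_take -eTU take_size_cat.
pose I := [set i : 'I_(size S) | val i \in s1].
have pI : perm_eq [seq val i | i <- enum I] s1.
  apply: uniq_perm; rewrite ?(map_inj_uniq val_inj) ?enum_uniq ?take_uniq //.
  move=> k; apply/mapP/idP => [[i iI ->]|ks1].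
    by rewrite mem_enum inE in iI.
  exists (Ordinal (ms _ (mem_take ks1))) => //.
  by rewrite mem_enum inE.
exists I; rewrite sumI (map_comp (nth 0 S) val) cardE -(size_map val) (perm_size pI).
rewrite (perm_big _ (perm_map (nth 0 S) pI)) -eT zT eqxx andbT.
by rewrite -sT [in X in _ == X]eT size_map.
Qed.

Lemma MZ_perm (G : finZmodType) (S T : seq G) : perm_eq S T -> MZ S = MZ T.
Proof.
move=> pST; rewrite /MZ (perm_size pST); apply: eq_bigl => r.
apply/has_zero_sumP/has_zero_sumP => -[A [B [pAB sA zA]]];
  exists A, B; split=> //; first exact: perm_trans pAB pST.
by rewrite perm_sym in pST; exact: perm_trans pAB pST.
Qed.

(* Main.v *)
Require Import Defs.
From mathcomp Require Import all_boot all_order all_algebra.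
From mathcomp Require Import constructive_ereal.
From mathcomp Require Import zify.

Set Implicit Arguments.
Unset Strict Implicit.
Unset Printing Implicit Defensive.

Import Order.TTheory GRing.Theory Num.Theory.
Local Open Scope ring_scope.

(* Let [k = r - 1], so that [S] has no nonempty zero-sum subsequence of length
   at most [k > n / 2]. Split [S] (up to multiplicity [k]) into [k] sets: in the
   sumset of these sets with [0] adjoined, [0] has only the trivial
   representation, so by Scherk's theorem the sumset has more than
   [\sum_x min(mult x, k)] elements. As this sumset lies in a group of order
   [n = |S|], some [g] occurs more than [k] times, and [g] generates the group
   since its order exceeds [n / 2]. Write every term as [y = (e(y) + 1) g] with
   [0 <= e(y) < n]. The [t - 1] elements of the support other than [g], completed
   by copies of [g], form a zero-sum subsequence of length [n - \sum e(y)], whence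
   [r <= n - \sum e(y) <= n - (1 + ... + (t - 1))]. *)

(** * Scherk's theorem on sumsets *)

(** Induction on [#|B|]: a Dyson transform shrinks [B], keeps [#|A| + #|B|], and does not enlarge
    the sumset. *)
Lemma scherk (G : finZmodType) (A B : {set G}) :
    0 \in A -> 0 \in B ->
    (forall a b, a \in A -> b \in B -> a + b = 0 -> b = 0) ->
  (#|A| + #|B| <= #|[set (a + b)%R | a in A, b in B]|.+1)%N.
Proof.
have [p] := ubnP #|B|; elim: p => // p IHp in A B *.
rewrite ltnS => leBp A0 B0 AB0.
have [sB0|] := boolP (B \subset [set 0]).
  have /eqP B1 : B == [set 0] by rewrite eqEsubset sB0 sub1set.
  rewrite B1 cards1 addn1 ltnS subset_leq_card //; apply/subsetP => a aA.
  by apply/imset2P; exists a 0; rewrite ?inE ?addr0.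
case/subsetPn => b bB; rewrite inE => b_neq0.
(* Otherwise translation by [b] permutes [A], so some [x] in [A] has [x + b = 0], which forces
   [b = 0]. *)
have [a aA abNA] : exists2 a, a \in A & a + b \notin A.
  apply/exists_inP; apply: contraR b_neq0; rewrite negb_exists_in.
  move/forall_inP => shA.
  have sAb : [set x + b | x in A] \subset A.
    by apply/subsetP => _ /imsetP[x xA ->]; have := shA x xA; rewrite negbK.
  have /eqP eAb : [set x + b | x in A] == A.
    by rewrite eqEcard sAb (card_imset _ (addIr b)) leqnn.
  have: 0 \in [set x + b | x in A] by rewrite eAb.
  by case/imsetP => x xA /esym xb0; apply/eqP; apply: (AB0 x).
(* Dyson transform *)
pose A' := A :|: [set a + x | x in B]; pose B' := [set x in B | a + x \in A].
have cAB : (#|A'| + #|B'| = #|A| + #|B|)%N.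
  have -> : #|B'| = #|A :&: [set a + x | x in B]|.
    rewrite -(card_imset _ (addrI a)); apply: eq_card => y; rewrite inE.
    apply/imsetP/andP => [[x + ->]|[yA /imsetP[x xB eyx]]].
      by rewrite inE => /andP[xB axA]; split=> //; apply: imset_f.
    by exists x; rewrite // inE xB -eyx.
  by rewrite cardsUI (card_imset _ (addrI a)).
have ltB'B : (#|B'| < #|B|)%N.
  apply/proper_card/properP; split; last by exists b; rewrite // inE bB.
  by apply/subsetP => x; rewrite inE => /andP[].
rewrite -cAB; apply: leq_trans (IHp A' B' _ _ _ _) _.
- exact: leq_trans ltB'B leBp.
- by rewrite inE A0.
- by rewrite inE B0 addr0.
- move=> a' b'; rewrite !inE => + /andP[b'B ab'A] ab'0.
  case/orP => [a'A|/imsetP[x xB ea']]; first exact: AB0 ab'0.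
  have ab'x0 : (a + b') + x = 0 by rewrite addrAC -ea'.
  have x0 := AB0 _ _ ab'A xB ab'x0.
  by move: ab'x0; rewrite x0 addr0; apply: (AB0 a).
rewrite ltnS subset_leq_card //; apply/subsetP => _ /imset2P[a' b' + + ->].
rewrite !inE => + /andP[b'B ab'A].
case/orP => [a'A|/imsetP[x xB ->]]; first exact: imset2_f.
by rewrite addrAC; exact: imset2_f.
Qed.

(** * Short zero-sum subsequences and a frequent term *)

(** Phrased by multiplicities, so that subsequences can be assembled without tracking positions. *)
Definition no_zero_sum_upto (G : finZmodType) (S : seq G) (k : nat) : Prop :=
  forall T : seq G, T != [::] -> (size T <= k)%N ->
    (forall x, count_mem x T <= count_mem x S)%N -> \sum_(x <- T) x != 0.

Lemma perm_cat_of_count (G : eqType) (T S : seq G) :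
    (forall x, count_mem x T <= count_mem x S)%N ->
  exists U, perm_eq (T ++ U) S.
Proof.
elim: T S => [|x T IHT] S cTS; first by exists S.
have xS : x \in S.
  by have := cTS x; rewrite /= eqxx -has_pred1 has_count; lia.
have [y|U pU] := IHT (rem x S).
  have := cTS y; rewrite (permP (perm_to_rem xS)) /=; lia.
exists U; rewrite perm_sym; apply: perm_trans (perm_to_rem xS) _.
by rewrite /= perm_cons perm_sym.
Qed.

Lemma no_zero_sum_uptoP (G : finZmodType) (S : seq G) (k : nat) :
  (forall r, (0 < r <= k)%N -> ~~ has_zero_sum S r) -> no_zero_sum_upto S k.
Proof.
move=> nz T T0 leTk /perm_cat_of_count[U pTU].
have /nz : (0 < size T <= k)%N by rewrite leTk lt0n size_eq0 T0.
by apply: contra => /eqP zT; apply/has_zero_sumP; exists T, U.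
Qed.

(* Scherk's theorem is iterated over the level sets [A] of the multiplicity
   function: an element chosen from [j] of them has multiplicity at least [j]. *)
Lemma sum_minn_count (G : finZmodType) (S : seq G) (k : nat) :
    no_zero_sum_upto S k ->
  (\sum_(x : G) minn (count_mem x S) k < #|G|)%N.
Proof.
move=> nzS.
have zS x : x \in S -> (0 < k)%N -> x != 0.
  move=> xS k0; have := nzS [:: x]; rewrite big_seq1; apply=> // y /=.
  by rewrite addn0; case: eqP => // <-; rewrite -has_count has_pred1.
pose good j (p : G) := exists T : seq G, [/\ (size T <= j)%N,
  forall x, (count_mem x T <= minn (count_mem x S) j)%N & p = \sum_(x <- T) x].
suff [P [P0 cP gP]] : exists P : {set G}, [/\ 0 \in P,
    (\sum_(x : G) minn (count_mem x S) k < #|P|)%N & forall p, p \in P -> good k p].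
  by apply: leq_trans cP _; exact: max_card.
suff: forall j, (j <= k)%N -> exists P : {set G}, [/\ 0 \in P,
    (\sum_(x : G) minn (count_mem x S) j < #|P|)%N & forall p, p \in P -> good j p].
  exact.
elim=> [_|j IHj ltjk].
  exists [set 0]; split; rewrite ?inE ?cards1 //.
    by rewrite big1 // => x _; rewrite minn0.
  move=> p; rewrite inE => /eqP ->; exists [::]; split=> //.
  by rewrite big_nil.
have [P [P0 cP gP]] := IHj (ltnW ltjk).
pose A := [set x | (j < count_mem x S)%N].
have inA (x : G) : (x \in A) = (j < count_mem x S)%N by rewrite inE.
have A0 : 0 \notin A.
  rewrite inA; apply/negP => lt0; have/zS : 0 \in S.
    by rewrite -has_pred1 has_count (leq_ltn_trans _ lt0).
  by move=> /(_ (leq_ltn_trans (leq0n j) ltjk)); rewrite eqxx.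
have ext (p a : G) : p \in P -> a \in A ->
    exists T : seq G, [/\ T != [::], (size T <= j.+1)%N,
  forall x, (count_mem x T <= minn (count_mem x S) j.+1)%N & p + a = \sum_(x <- T) x].
  move=> /gP[T [sT cT ->]]; rewrite inA => aA.
  exists (a :: T); split=> //; last by rewrite big_cons addrC.
  by move=> x; move: aA (cT x) => /=; case: eqP => [<-|_]; lia.
pose Q : {set G} := [set a + b | a in P, b in 0 |: A].
exists Q; split.
- by apply/imset2P; exists 0 0; rewrite ?setU11 ?addr0.
- have -> : (\sum_(x : G) minn (count_mem x S) j.+1 =
             \sum_(x : G) minn (count_mem x S) j + #|A|)%N.
    rewrite -sum1_card [X in (_ + X)%N]big_mkcond -big_split /=.
    by apply: eq_bigr => x _; rewrite inA /=; case: ltnP; lia.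
  have : (#|P| + #|A|.+1 <= #|Q|.+1)%N; last by lia.
  have -> : (#|A|.+1 = #|0%R |: A|)%N by rewrite cardsU1 A0.
  (* If [p + a = 0] with [a] in [A], the sequence given by [ext] is a forbidden short zero-sum. *)
  apply: scherk => [||p a pP]; rewrite ?setU11 // in_setU1.
  case/orP => [/eqP //|aA] pa0.
  have [T [T0 sT cT eT]] := ext p a pP aA.
  have /nzS/(_ (leq_trans sT ltjk)) := T0; rewrite -eT pa0 eqxx.
  by case/(_ _)/negP => // x; have := cT x; lia.
move=> q /imset2P[p a pP]; rewrite in_setU1 => /orP[/eqP ->|aA] ->.
  have [T [sT cT eT]] := gP p pP; exists T; split.
  - lia.
  - by move=> x; have := cT x; lia.
  - by rewrite addr0.
by have [T [_ sT cT eT]] := ext p a pP aA; exists T.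
Qed.

(** If no multiplicity exceeded [k], the truncated multiplicities would add up to [size S], which is
    at least [#|G|]. *)
Lemma large_multiplicity (G : finZmodType) (S : seq G) (k : nat) :
    no_zero_sum_upto S k -> (#|G| <= size S)%N ->
  exists g, (k < count_mem g S)%N.
Proof.
move=> /sum_minn_count nzS leGS; apply/existsP; apply: contraLR nzS.
rewrite negb_exists -leqNgt => /forallP cS; apply: leq_trans leGS _.
rewrite (eq_bigr (fun x => count_mem x S)) => [|x _]; last first.
  by apply/minn_idPl; rewrite leqNgt.
under eq_bigr do rewrite -sum1_count.
by rewrite -sum1_size (partition_big id xpredT).
Qed.

(** * The frequent term as generator, and the excess of the other terms *)

Lemma big_nseq_mulrn (G : zmodType) (i : nat) (g : G) :
  \sum_(x <- nseq i g) x = g *+ i.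
Proof. by rewrite big_nseq; elim: i => //= i ->; rewrite mulrS. Qed.

(** If the gcd [d] exceeds 1, then [n / d] copies of [g] sum to zero, and [n / d <= n / 2 < k]. *)
Lemma coprime_of_multiplicity (m k : nat) (S : seq 'I_m.+1) (g : 'I_m.+1) :
    no_zero_sum_upto S k -> (m.+1 < 2 * k)%N -> (k < count_mem g S)%N ->
  coprime m.+1 g.
Proof.
move=> nzS ltmk gS; rewrite /coprime eqn_leq gcdn_gt0 andbT leqNgt.
apply/negP => c_gt1.
have [/dvdnP[i ei] /dvdnP[j ej]] := (dvdn_gcdl m.+1 g, dvdn_gcdr m.+1 g).
have [i_gt0 leik] : (0 < i /\ i <= k)%N by split; nia.
have := nzS (nseq i g); rewrite big_nseq_mulrn Zp_mulrn size_nseq.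
have -> : inZp (g * i) = 0 :> 'I_m.+1.
  by apply/val_inj; rewrite /= {1}ej -mulnA [(_ * i)%N]mulnC -ei modnMl.
rewrite eqxx => /(_ _ _ _)/negP[] //.
- by case: i i_gt0 {ei leik}.
- move=> x; rewrite count_nseq /=; case: eqP => [<-|_] //.
  by rewrite mul1n (leq_trans leik) // ltnW.
Qed.

(** Multiples are counted from 1, so that the inverse map is the excess [e], which vanishes only at
    [g]. *)
Lemma mulrnS_inj (m : nat) (g : 'I_m.+1) :
  coprime m.+1 g -> injective (fun i : 'I_m.+1 => g *+ i.+1).
Proof.
move=> cop.
have leinj (i j : 'I_m.+1) : (i <= j)%N -> g *+ i.+1 = g *+ j.+1 -> i = j.
  move=> leij /(congr1 val); rewrite !Zp_mulrn /= => /esym/eqP.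
  rewrite eqn_mod_dvd ?leq_mul // -mulnBr Gauss_dvdr // subSS => dv.
  apply/val_inj/eqP; rewrite eqn_leq leij -subn_eq0.
  apply: contraTT dv; rewrite -lt0n => /gtnNdvd -> //.
  exact: leq_ltn_trans (leq_subr _ _) (ltn_ord j).
by move=> i j; case: (leqP i j) => [/leinj//|/ltnW/leinj H /esym/H].
Qed.

(* Completing [L] with copies of [g] to a zero-sum sequence of length
   [n - \sum e] bounds the excess; adding the terms in decreasing order keeps
   the partial sums of the [(e y).+1] at most [n]. *)
Lemma sum_excess (m k : nat) (S : seq 'I_m.+1) (g : 'I_m.+1)
    (e : 'I_m.+1 -> 'I_m.+1) (L : seq 'I_m.+1) :
    no_zero_sum_upto S k -> (k < m.+1 < 2 * k)%N -> (k < count_mem g S)%N ->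
    (forall y, g *+ (e y).+1 = y) ->
    {subset L <= S} -> g \notin L -> sorted ltn [seq (e y : nat) | y <- L] ->
  (\sum_(y <- L) e y + k < m.+1)%N.
Proof.
move=> nzS /andP[ltkm ltmk] gS eK; elim: L => [|x L IHL] LS gL srt.
  by rewrite big_nil.
have {}IHL : (\sum_(y <- L) e y + k < m.+1)%N.
  apply: IHL; last exact: path_sorted srt.
  - by move=> y yL; apply: LS; rewrite inE yL orbT.
  - by move: gL; rewrite inE negb_or => /andP[].
have /map_uniq uL := sorted_uniq ltn_trans ltnn srt.
have ex_gt0 : (0 < e x)%N.
  rewrite lt0n; apply: contra gL => /eqP ex0.
  by rewrite -[g]mulr1n -ex0 eK mem_head.
have exL : (e x * size L <= \sum_(y <- L) e y)%N.
  have := order_path_min ltn_trans srt; rewrite all_map => /allP lex.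
  rewrite -sum1_size big_distrr /= !big_seq leq_sum // => y /lex /=.
  by rewrite muln1; apply: ltnW.
have sumS (L' : seq 'I_m.+1) :
    (\sum_(y <- L') (e y).+1 = \sum_(y <- L') e y + size L')%N.
  by rewrite -sum1_size -big_split /=; apply: eq_bigr => y _; rewrite addn1.
(* For nonempty [L] with excess sum [E], [exL] gives [e x + size L <= E + 1], so the total is at
   most [2E + 2 <= 2(n - k) < n]. *)
have s_le : (\sum_(y <- x :: L) (e y).+1 <= m.+1)%N.
  rewrite sumS big_cons /=; have := ltn_ord (e x); move: exL IHL.
  case: (L) => [|y L']; first by rewrite big_nil /= !addn0 addn1.
  set E := (\sum_(z <- _) _)%N; rewrite /= => exL IHL _.
  have : (e x + (size L').+1 <= e x * (size L').+1 + 1)%N by nia.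
  by nia.
(* If the excess sum of [x :: L] were at least [n - k], the completed zero-sum sequence would have
   length at most [k]. *)
rewrite ltnNge; apply/negP => le_ek.
have := sumS (x :: L); set s := (\sum_(z <- _) _)%N in s_le * => es.
set E := (\sum_(z <- _) _)%N in le_ek es.
have := nzS ((x :: L) ++ nseq (m.+1 - s) g); rewrite size_cat size_nseq.
have -> : \sum_(y <- (x :: L) ++ nseq (m.+1 - s) g) y = 0.
  rewrite big_cat big_nseq_mulrn -(eq_bigr _ (fun y _ => eK y)) /=.
  rewrite (@sumrMnr 'I_m.+1) -/s -mulrnDr subnKC // Zp_mulrn.
  by apply/val_inj; rewrite /= modnMl.
rewrite eqxx => /(_ _ _ _)/negP[] //; first by move: es => /=; lia.
move=> y; rewrite count_cat count_nseq count_uniq_mem //=.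
case: eqP => [<-|_].
  by rewrite (negbTE gL) add0n mul1n (leq_trans _ (ltnW gS)) //; lia.
rewrite mul0n addn0; case: (boolP (y \in _)) => // /LS.
by rewrite -has_pred1 has_count.
Qed.

(** The [i]-th entry, counted from 1, is at least [x + i]. *)
Lemma bin2_le_sum (l : seq nat) (x : nat) :
  path ltn x l -> (x * size l + 'C((size l).+1, 2) <= sumn l)%N.
Proof.
elim: l x => [|y l IHl] x /=; first by rewrite muln0.
case/andP=> [ltxy /IHl].
by rewrite (binS (size l).+1 1) bin1; nia.
Qed.

Lemma bin_card_supp_lt (m k : nat) (S : seq 'I_m.+1) :
    size S = m.+1 -> (m.+1 < 2 * k)%N -> no_zero_sum_upto S k ->
  (k + 'C(#|supp S|, 2) < m.+1)%N.
Proof.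
move=> hS ltmk nzS.
have [|g gS] := large_multiplicity nzS; first by rewrite card_ord hS.
have ltkm : (k < m.+1)%N by rewrite (leq_trans gS) // -hS count_size.
pose finj := mulrnS_inj (coprime_of_multiplicity nzS ltmk gS).
pose e := invF finj.
pose r := [rel x y | e x <= e y]%N.
pose L := sort r (rem g (undup S)).
have gL : g \notin L by rewrite mem_sort mem_rem_uniqF ?undup_uniq.
have eK y : g *+ (e y).+1 = y by exact: (f_invF finj).
have LS : {subset L <= S}.
  by move=> y; rewrite mem_sort => /mem_rem; rewrite mem_undup.
have srtL : sorted ltn [seq (e y : nat) | y <- L].
  rewrite ltn_sorted_uniq_leq map_inj_uniq; last first.
    by move=> y z /val_inj/(can_inj (f_invF finj)).
  rewrite sort_uniq rem_uniq ?undup_uniq //=.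
  by rewrite sorted_map; apply: sort_sorted => y z; exact: leq_total.
have := sum_excess nzS _ gS eK LS gL srtL; rewrite ltkm ltmk => /(_ isT).
apply: leq_ltn_trans; rewrite addnC leq_add2r.
have gS' : g \in undup S.
  by rewrite mem_undup -has_pred1 has_count (leq_ltn_trans _ gS).
have <- : (size L).+1 = #|supp S|.
  rewrite size_sort size_rem // prednK; last by case: (undup S) gS'.
  rewrite -(card_uniqP (undup_uniq S)); apply: eq_card => x.
  by rewrite inE mem_undup.
have pL : path ltn 0 [seq (e y : nat) | y <- L].
  rewrite path_sortedE ?srtL ?andbT; last exact: ltn_trans.
  rewrite all_map; apply/allP => y yL /=; rewrite lt0n.
  by apply: contra gL => /eqP ey0; rewrite -[g]mulr1n -ey0 eK.
by have := bin2_le_sum pL; rewrite mul0n size_map sumnE big_map.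
Qed.

(** * Translation to [MZ] *)

Local Open Scope ereal_scope.

Lemma MZ_le (G : finZmodType) (S : seq G) (r : nat) :
  (0 < r <= size S)%N -> has_zero_sum S r -> MZ S <= r%:R%:E.
Proof.
by move=> r_rng zr; apply: (@bigmin_inf_seq _ _ _ _ _ r); rewrite ?mem_index_iota.
Qed.

(* ['I_m.+1] with its canonical addition is the cyclic group of order
   [n = m.+1]; this form covers every [n >= 1], unlike ['Z_n]. *)
Theorem theorem4p1 (m n : nat) (hn : n = m.+1) (S : seq 'I_m.+1)
    (hS : size S = n) :
  (n%:R / 2)%R%:E < MZ S - 1 ->
  MZ S <= (n%:R - 'C(#|supp S|, 2)%:R)%R%:E.
Proof.
subst n => ltMZ.
have exP : exists r, (0 < r <= size S)%N && has_zero_sum S r.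
  have [/hasP[r]|/hasPn nP] :=
      boolP (has (has_zero_sum S) (index_iota 1 (size S).+1)).
    by rewrite mem_index_iota ltnS => r_rng zr; exists r; rewrite r_rng.
  (* This excludes [MZ S = +oo]: with [k = n] the bound would read [n + 'C(t, 2) < n]. *)
  have : no_zero_sum_upto S m.+1.
    apply: no_zero_sum_uptoP => r; rewrite -hS => r_rng.
    by rewrite nP // mem_index_iota.
  by move=> /(bin_card_supp_lt hS); lia.
case: (ex_minnP exP) => r /andP[r_rng zr] r_min.
have leMZ := MZ_le r_rng zr.
apply: (le_trans leMZ); rewrite lee_fin lerBrDr -natrD ler_nat.
have : (m.+1%:R / 2)%R%:E < r%:R%:E - 1 :> \bar rat.
  by apply: lt_le_trans ltMZ _; apply: leeB.
(* With [r = k + 1], the hypothesis becomes [n < 2 * k], and minimality of [r] excludes zero-sums of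
   length at most [k]. *)
case: r r_rng zr r_min {leMZ} => // k /= k_rng _ k_min.
rewrite -EFinB lte_fin -[in ltRHS]natr1 addrK ltr_pdivrMr // -natrM ltr_nat => ltk.
rewrite addSn; apply: (bin_card_supp_lt hS); first by rewrite mulnC.
apply: no_zero_sum_uptoP => r r_rng; apply/negP => zr.
have := k_min r; rewrite zr andbT => /(_ _); lia.
Qed.
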